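(* Let $\mathbf{C}$ be a translating-rotating soliton with $\alpha=0$, rotation matrix $\mathcal{A}$ and translation velocity $\mathbf{v}$, $\mathcal{A}\mathbf{v}=0$. Then the orthogonal projection of $\mathbf{C}$ onto the null space $N(\mathcal{A})$ of $\mathcal{A}$ is contained in a two dimensional affine subspace of $N(\mathcal{A})$. In particular, all purely translating solitons ($\alpha=0$, $\mathcal{A}=0$, $\mathbf{v}\neq0$) are planar: they are copies of the Grim Reaper.
   Context: A translating-rotating soliton with parameters $(\mathcal{A},\mathbf{v})$ ($\mathcal{A}$ a real antisymmetric $n\times n$ matrix, $\mathbf{v}\in\mathbb{R}^n$ with $\mathcal{A}\mathbf{v}=0$) is a curve $\mathbf{C}$ in $\mathbb{R}^n$, parametrized by arc length $s$, which satisfies $\mathbf{C}_{ss}=\mathcal{A}\mathbf{C}+\mathbf{v}+\lambda\mathbf{C}_s$, where $\lambda(s)$ is determined by the condition $\mathbf{C}_s\perp\mathbf{C}_{ss}$; this is the general soliton equation $\mathbf{C}_{ss}=(\alpha+\mathcal{A})\mathbf{C}+\mathbf{v}+\lambda\mathbf{C}_s$ with dilation parameter $\alpha=0$. The Grim Reaper is the graph of $y=-\log\cos x$ in the plane, which moves under Curve Shortening by steady translation along the $y$-axis.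
   Formalization: Straight lines parallel to v also solve the purely translating equation, so they are admitted as an alternative to copies of the Grim Reaper; and the affine subspace has dimension min(2, dim N(A)), since N(A) may have dimension below two. *)

(* Defs.v *)
From HB Require Import structures.
From mathcomp Require Import all_boot all_order all_algebra.
From mathcomp Require Import all_classical all_reals all_analysis.

Set Implicit Arguments.
Unset Strict Implicit.
Unset Printing Implicit Defensive.

Import Order.TTheory GRing.Theory Num.Theory.
Import numFieldNormedType.Exports.

Local Open Scope classical_set_scope.
Local Open Scope ring_scope.

(* The library norm on ['cV[R]_n] is the sup norm, so Euclidean lengths and
   orthogonality go through [dot]; derivatives do not depend on the norm. *)
Definition dot (R : realType) (n : nat) (x y : 'cV[R]_n) : R :=
  \sum_(i < n) x i 0 * y i 0.

Definition antisym_mx (R : realType) (n : nat) (A : 'M[R]_n) : Prop :=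
  A^T = - A.

Definition nullspace (R : realType) (n : nat) (A : 'M[R]_n) : set 'cV[R]_n :=
  [set x | A *m x = 0].

(* [kermx] is a left kernel, hence the transpose. *)
Definition nullity (R : realType) (n : nat) (A : 'M[R]_n) : nat :=
  \rank (kermx A^T).

(* p is the orthogonal projection of x onto the linear subspace V. *)
Definition is_orth_proj (R : realType) (n : nat) (V : set 'cV[R]_n)
    (x p : 'cV[R]_n) : Prop :=
  V p /\ forall y, V y -> dot (x - p) y = 0.

(* The columns of B are a basis of the direction space of W. *)
Definition affine_subspace (R : realType) (n d : nat) (W : set 'cV[R]_n) :
    Prop :=
  exists (p : 'cV[R]_n) (B : 'M[R]_(n, d)),
    \rank B = d /\ W = [set p + B *m t | t in [set: 'cV[R]_d]].

Definition arclength_curve (R : realType) (n : nat) (I : set R)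
    (C : R -> 'cV[R]_n) : Prop :=
  [/\ open I, is_interval I, I !=set0 &
      forall s, I s ->
        [/\ derivable C s 1, derivable (derive1 C) s 1 &
            dot (derive1 C s) (derive1 C s) = 1]].

Definition soliton (R : realType) (n : nat) (alpha : R) (A : 'M[R]_n)
    (v : 'cV[R]_n) (I : set R) (C : R -> 'cV[R]_n) : Prop :=
  arclength_curve I C /\
  exists lambda : R -> R, forall s, I s ->
    derive1n 2 C s = (alpha%:M + A) *m C s + v + lambda s *: derive1 C s
    /\ dot (derive1 C s) (derive1n 2 C s) = 0.

(* The branch |x| < pi / 2 of the graph y = - log cos x. *)
Definition grim_reaper (R : realType) : set 'cV[R]_2 :=
  [set z | - (pi / 2) < z ord0 0 < pi / 2
           /\ z ord_max 0 = - ln (cos (z ord0 0))].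

(* A copy is the image under a similarity of the plane into R^n; the dilation
   factor is needed because the standard Grim Reaper has unit speed. *)
Definition grim_reaper_copy (R : realType) (n : nat) (G : set 'cV[R]_n) :
    Prop :=
  exists (p : 'cV[R]_n) (r : R) (Q : 'M[R]_(n, 2)),
    [/\ 0 < r, Q^T *m Q = 1%:M &
        G = [set p + r *: (Q *m z) | z in @grim_reaper R]].

(* Main.v *)
Require Import Defs.
From HB Require Import structures.
From mathcomp Require Import all_boot all_order all_algebra.
From mathcomp Require Import all_classical all_reals all_analysis.
From mathcomp Require Import ring lra.

Set Implicit Arguments.
Unset Strict Implicit.
Unset Printing Implicit Defensive.

Import Order.TTheory GRing.Theory Num.Theory.
Import numFieldNormedType.Exports.

Local Open Scope classical_set_scope.
Local Open Scope ring_scope.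

(** Let [T] be the unit tangent.  Since [T] is orthogonal to its derivative, the
    multiplier is forced to be [lambda = - <T, A C + v>], which is continuous.

    Affine containment.  If a matrix [L] kills [A] and [v], then applying it to
    the soliton equation leaves the linear homogeneous equation
    [(L T)' = lambda (L T)].  Hence [L T] vanishes identically as soon as it
    vanishes at one point, and then [L C] is constant ([soliton_conserved]).
    Because [A] is antisymmetric, the orthogonal projector [P] onto its null
    space kills [A] on both sides.  Taking for [L] the projector followed by
    the equations of a subspace that contains [v] and [P T(s0)] shows that
    [P C - P C(s0)] stays in that subspace.  It is at most two-dimensional, and
    it is enlarged inside the null space to dimension exactly
    [minn 2 (nullity A)] ([intermediate_row_space]).

    Translating solitons.  Write [v = c e] with [e] a unit vector and let
    [u = <e, T>] be the tilt of the curve.  Then [T' = c (e - u T)],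
    [u' = c (1 - u^2)] and [(1 - u^2)' = - 2 c u (1 - u^2)], so that [1 - u^2]
    either vanishes identically or never vanishes.  In the first case [T] is a
    constant multiple of [e] and the curve lies on a line parallel to [v]
    ([vertical_soliton_line]).  In the second case [sqrt (1 - u^2)] and each
    coordinate of [T - u e] satisfy the same linear equation [h' = - c u h], so
    that [T = u e + sqrt (1 - u^2) f] for a fixed unit vector [f] orthogonal to
    [e] ([nonvertical_soliton_frame]).  With [theta = asin u], the vector
    [c C - theta f + ln (cos theta) e] has zero derivative, which exhibits [C]
    on a Grim Reaper of scale [1 / c].  When the curve is defined on the whole
    line, [ln (1 + u) - ln (1 - u)] is affine in [s] with slope [2 c], so [u]
    takes every value in ]-1, 1[ and the whole Grim Reaper is covered. *)

(** * Scalar linear equations and coordinatewise derivatives *)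

Lemma is_derive_continuous (R : realType) (h : R -> R) (x dh : R) :
  is_derive x 1 h dh -> {for x, continuous h}.
Proof.
by move=> hx; apply/differentiable_continuous/derivable1_diffP; case: hx.
Qed.

(** Uniqueness of the zero solution: on a segment where [|mu| <= M], the function
    [h^2 exp (N x)] is nonincreasing for [N = - 2 M] and nondecreasing for
    [N = 2 M]. *)
Lemma linear_ode_eq0 (R : realType) (I : set R) (h mu : R -> R) (s0 s : R) :
  is_interval I -> (forall x, I x -> {for x, continuous mu}) ->
  (forall x, I x -> is_derive x 1 h (mu x * h x)) ->
  I s0 -> h s0 = 0 -> I s -> h s = 0.
Proof.
move=> itvI cmu dh Is0 hs0 Is.
have itvab a b x : I a -> I b -> x \in `[a, b] -> I x.
  by move=> Ia Ib; rewrite in_itv/=; exact: itvI.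
have bound a b : a <= b -> I a -> I b ->
    exists M, forall x, x \in `[a, b] -> `|mu x| <= M.
  move=> ab Ia Ib.
  have cnmu : {within `[a, b], continuous (fun x => `|mu x|)}.
    apply: continuous_in_subspaceT => x; rewrite inE /= => xab.
    apply: continuous_comp; first by apply: cmu; exact: (itvab a b).
    exact: norm_continuous.
  by have [c _ cmax] := EVT_max ab cnmu; exists `|mu c|.
pose k N x := h x * h x * expR (N * x).
have dk N x : I x -> is_derive x 1 (k N) ((2 * mu x + N) * k N x).
  move=> Ix.
  have dE : is_derive x 1 (fun y => expR (N * y)) (expR (N * x) * N).
    apply: (@is_derive1_comp _ expR (fun y => N * y)).
    by apply: (is_derive_eq (is_deriveZ N (is_derive_id x 1)));
      rewrite /GRing.scale /= mulr1.
  apply: (is_derive_eq (is_deriveM (is_deriveM (dh x Ix) (dh x Ix)) dE)).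
  by rewrite /k !fctE /GRing.scale /=; ring.
have mvt N a b : a <= b -> I a -> I b ->
    exists2 x, x \in `[a, b] & k N b - k N a = (2 * mu x + N) * k N x * (b - a).
  move=> ab Ia Ib; apply: MVT_segment => // [x xab|].
    by apply/dk/(itvab a b) => //; exact: subset_itv_oo_cc.
  apply: continuous_in_subspaceT => x; rewrite inE /= => xab.
  by apply: is_derive_continuous (dk N x _); exact: (itvab a b).
have k_ge0 N x : 0 <= k N x by rewrite mulr_ge0 ?expR_ge0 -?expr2 ?sqr_ge0.
have k0 N : k N s0 = 0 by rewrite /k hs0 !mul0r.
suff [N kN] : exists N, k N s <= 0.
  have /eqP : k N s = 0 by apply/le_anti; rewrite kN k_ge0.
  by rewrite mulf_eq0 (gt_eqF (expR_gt0 _)) orbF mulf_eq0 orbb => /eqP.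
have [le|/ltW le] := leP s0 s.
- have [M boundM] := bound _ _ le Is0 Is; exists (- (2 * M)).
  have [x /boundM] := mvt (- (2 * M)) _ _ le Is0 Is.
  rewrite ler_norml k0 subr0 => /andP[_ leM] ->.
  apply: mulr_le0_ge0; last by rewrite subr_ge0.
  by apply: mulr_le0_ge0 => //; lra.
- have [M boundM] := bound _ _ le Is Is0; exists (2 * M).
  have [x /boundM] := mvt (2 * M) _ _ le Is Is0.
  rewrite ler_norml k0 sub0r => /andP[leM _] kE.
  rewrite -oppr_ge0 kE mulr_ge0 ?subr_ge0 // mulr_ge0 //; lra.
Qed.

Lemma derive_eq0_const (R : realType) (I : set R) (h : R -> R) (s0 s : R) :
  is_interval I -> (forall x, I x -> is_derive x 1 h 0) ->
  I s0 -> I s -> h s = h s0.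
Proof.
move=> itvI dh Is0 Is; apply/eqP; rewrite -subr_eq0; apply/eqP.
apply: (@linear_ode_eq0 _ I (fun x => h x - h s0) (cst 0) s0 s) => //; last first.
- by rewrite subrr.
- move=> x Ix.
  apply: (is_derive_eq (is_deriveB (dh x Ix) (is_derive_cst (h s0) x 1))).
  by rewrite /= mul0r subr0.
- by move=> x _; exact: cst_continuous.
Qed.

Lemma is_derive_coord (R : realType) (n : nat) (C : R -> 'cV[R]_n) (x : R)
    (i : 'I_n) :
  derivable C x 1 -> is_derive x 1 (fun y => C y i 0) (derive1 C x i 0).
Proof.
move=> dC; apply: DeriveDef; first by move/derivable_mxP : dC; exact.
by rewrite derive1E derive_mx // mxE.
Qed.

Lemma is_derive_mulmx (R : realType) (m n : nat) (L : 'M[R]_(m, n))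
    (F : R -> 'cV[R]_n) (x : R) (dF : 'cV[R]_n) (i : 'I_m) :
  (forall j, is_derive x 1 (fun y => F y j 0) (dF j 0)) ->
  is_derive x 1 (fun y => (L *m F y) i 0) ((L *m dF) i 0).
Proof.
move=> dFx.
have -> : (fun y => (L *m F y) i 0) = \sum_(j < n) (fun y => L i j * F y j 0).
  by apply/funext => y; rewrite mxE fct_sumE.
by rewrite mxE; apply: is_derive_sum => j; exact: is_deriveZ.
Qed.

Lemma is_derive_dot (R : realType) (n : nat) (F G : R -> 'cV[R]_n) (x : R)
    (dF dG : 'cV[R]_n) :
  (forall i, is_derive x 1 (fun y => F y i 0) (dF i 0)) ->
  (forall i, is_derive x 1 (fun y => G y i 0) (dG i 0)) ->
  is_derive x 1 (fun y => dot (F y) (G y)) (dot dF (G x) + dot (F x) dG).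
Proof.
move=> dFx dGx.
have -> : (fun y => dot (F y) (G y)) =
    \sum_(j < n) (fun y => F y j 0 * G y j 0).
  by apply/funext => y; rewrite /dot fct_sumE.
rewrite /dot -big_split /=; apply: is_derive_sum => i.
by apply: (is_derive_eq (is_deriveM (dFx i) (dGx i)));
  rewrite ?fctE /GRing.scale /=; ring.
Qed.

(** * The Euclidean product *)

Lemma dotE (R : realType) (n : nat) (x y : 'cV[R]_n) :
  dot x y = (x^T *m y) 0 0.
Proof. by rewrite mxE; apply: eq_bigr => i _; rewrite mxE. Qed.

Lemma dotC (R : realType) (n : nat) (x y : 'cV[R]_n) : dot x y = dot y x.
Proof. by apply: eq_bigr => i _; rewrite mulrC. Qed.

Lemma dotDr (R : realType) (n : nat) (x y z : 'cV[R]_n) :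
  dot x (y + z) = dot x y + dot x z.
Proof. by rewrite !dotE mulmxDr mxE. Qed.

Lemma dotZr (R : realType) (n : nat) (a : R) (x y : 'cV[R]_n) :
  dot x (a *: y) = a * dot x y.
Proof. by rewrite !dotE -scalemxAr mxE. Qed.

Lemma dotDl (R : realType) (n : nat) (x y z : 'cV[R]_n) :
  dot (x + y) z = dot x z + dot y z.
Proof. by rewrite !(dotC _ z) dotDr. Qed.

Lemma dotZl (R : realType) (n : nat) (a : R) (x y : 'cV[R]_n) :
  dot (a *: x) y = a * dot x y.
Proof. by rewrite !(dotC _ y) dotZr. Qed.

Lemma dotNr (R : realType) (n : nat) (x y : 'cV[R]_n) : dot x (- y) = - dot x y.
Proof. by rewrite -scaleN1r dotZr mulN1r. Qed.

Lemma dotNl (R : realType) (n : nat) (x y : 'cV[R]_n) : dot (- x) y = - dot x y.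
Proof. by rewrite !(dotC _ y) dotNr. Qed.

Lemma dot_ge0 (R : realType) (n : nat) (x : 'cV[R]_n) : 0 <= dot x x.
Proof. by apply: sumr_ge0 => i _; rewrite -expr2 sqr_ge0. Qed.

Lemma dot_eq0 (R : realType) (n : nat) (x : 'cV[R]_n) : dot x x = 0 -> x = 0.
Proof.
move=> /eqP; rewrite psumr_eq0; last by move=> i _; rewrite -expr2 sqr_ge0.
move=> /allP x0; apply/colP => i; rewrite mxE.
by have := x0 i (mem_index_enum i); rewrite mulf_eq0 orbb => /eqP.
Qed.

(** * Linear algebra *)

(** Between two nested subspaces there is one of any intermediate dimension. *)
Lemma intermediate_row_space (F : fieldType) (m1 m2 n d : nat)
    (U : 'M[F]_(m1, n)) (K : 'M[F]_(m2, n)) :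
  (U <= K)%MS -> (\rank U <= d <= \rank K)%N ->
  exists B : 'M[F]_(d, n), [/\ (U <= B)%MS, (B <= K)%MS & \rank B = d].
Proof.
move=> UK; elim: d => [|d IHd] /andP[].
  rewrite leqn0 mxrank_eq0 => /eqP -> _.
  by exists 0; rewrite !sub0mx mxrank0.
rewrite leq_eqVlt => /predU1P[<- _|Ud dK].
  by exists (row_base U); rewrite !eq_row_base submx_refl UK.
have [|B [UB BK rB]] := IHd; first by rewrite -ltnS Ud ltnW.
have /row_subPn[i nKB] : ~~ (K <= B)%MS.
  by apply: contraL dK => /mxrankS; rewrite rB -leqNgt.
have UB' : (U <= col_mx (row i K) B)%MS.
  by rewrite (submx_trans UB) // -addsmxE addsmxSr.
have BK' : (col_mx (row i K) B <= K)%MS by rewrite col_mx_sub row_sub.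
have rB' : \rank (col_mx (row i K) B) = d.+1.
  apply/eqP; rewrite eqn_leq rank_leq_row /= -{1}rB.
  have BB' : (B <= col_mx (row i K) B)%MS by rewrite -addsmxE addsmxSr.
  by rewrite (ltn_leqif (mxrank_leqif_sup BB')) col_mx_sub submx_refl andbT.
by exists (col_mx (row i K) B).
Qed.

(** The orthogonal projector onto the null space of [A].  If the rows of [K] form
    a basis of the null space, it is [K^T (K K^T)^-1 K]; antisymmetry gives
    [K A = 0] in addition to [A K^T = 0]. *)
Lemma orth_projector (R : realType) (n : nat) (A : 'M[R]_n) :
  antisym_mx A ->
  exists P : 'M[R]_n, [/\ P *m A = 0, A *m P = 0, P^T = P &
    forall x : 'cV[R]_n, A *m x = 0 -> P *m x = x].
Proof.
move=> asA.
have [r [K [Kfree KA0 Kfull]]] : exists r (K : 'M[R]_(r, n)),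
    [/\ row_free K, K *m A^T = 0 &
      forall x : 'cV[R]_n, A *m x = 0 -> (x^T <= K)%MS].
  exists (\rank (kermx A^T)), (row_base (kermx A^T)); split.
  - exact: row_base_free.
  - by apply/sub_kermxP; rewrite eq_row_base.
  - by move=> x Ax; rewrite eq_row_base; apply/sub_kermxP;
      rewrite -trmx_mul Ax trmx0.
have AK0 : A *m K^T = 0 by apply: trmx_inj; rewrite trmx_mul trmxK KA0 trmx0.
have KA : K *m A = 0 by rewrite -[A]opprK -asA mulmxN KA0 oppr0.
pose G := K *m K^T.
have Gunit : G \in unitmx.
  rewrite -row_free_unit; apply: inj_row_free => x xG0.
  have /dot_eq0 xK0 : dot (x *m K)^T (x *m K)^T = 0.
    by rewrite dotE trmxK trmx_mul mulmxA -(mulmxA x) -/G xG0 mul0mx mxE.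
  by apply: (row_free_inj Kfree); rewrite mul0mx -[LHS]trmxK xK0 trmx0.
have Gsym : G^T = G by rewrite trmx_mul trmxK.
exists (K^T *m invmx G *m K); split.
- by rewrite -mulmxA KA mulmx0.
- by rewrite !mulmxA AK0 !mul0mx.
- by rewrite !trmx_mul trmxK trmx_inv Gsym mulmxA.
- move=> x /Kfull /submxP[t xtK].
  have -> : x = K^T *m t^T by rewrite -trmx_mul -xtK trmxK.
  by rewrite -(mulmxA _ K) (mulmxA K) -/G -mulmxA mulKmx.
Qed.

(** * Solitons without dilation *)

Lemma soliton_derivable (R : realType) (n : nat) (alpha : R) (A : 'M[R]_n)
    (v : 'cV[R]_n) (I : set R) (C : R -> 'cV[R]_n) (s : R) (i : 'I_n) :
  soliton alpha A v I C -> I s ->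
  is_derive s 1 (fun x => C x i 0) (derive1 C s i 0) /\
  is_derive s 1 (fun x => derive1 C x i 0) (derive1n 2 C s i 0).
Proof.
by move=> [[_ _ _ curve] _] /curve[dC ddC _]; split; exact: is_derive_coord.
Qed.

(** The multiplier [lambda] is determined by the orthogonality of the tangent and
    the acceleration. *)
Lemma soliton_acceleration (R : realType) (n : nat) (A : 'M[R]_n)
    (v : 'cV[R]_n) (I : set R) (C : R -> 'cV[R]_n) (s : R) :
  soliton 0 A v I C -> I s ->
  derive1n 2 C s =
    A *m C s + v - dot (derive1 C s) (A *m C s + v) *: derive1 C s.
Proof.
move=> [[_ _ _ curve] [lambda eqn]] Is.
have [_ _ unit] := curve s Is; have [accE orth] := eqn s Is.
move: accE; rewrite raddf0 add0r => accE.
rewrite {}accE dotDr dotZr unit mulr1 in orth *.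
by rewrite -scaleNr -(addr0_eq orth).
Qed.

(** Each row of [L] is a linear functional whose derivative along the curve
    satisfies a homogeneous linear equation, so it is conserved once its
    derivative vanishes at [s0]. *)
Lemma soliton_conserved (R : realType) (m n : nat) (A : 'M[R]_n)
    (v : 'cV[R]_n) (I : set R) (C : R -> 'cV[R]_n) (L : 'M[R]_(m, n))
    (s0 s : R) :
  soliton 0 A v I C -> L *m A = 0 -> L *m v = 0 ->
  I s0 -> L *m derive1 C s0 = 0 -> I s -> L *m C s = L *m C s0.
Proof.
move=> sol LA Lv Is0 LT0 Is.
have itvI : is_interval I by case: sol => -[].
have dC x i (Ix : I x) := soliton_derivable i sol Ix.
pose mu x := - dot (derive1 C x) (A *m C x + v).
have cmu x : I x -> {for x, continuous mu}.
  move=> Ix.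
  have dAC i : is_derive x 1 (fun y => (A *m C y + v) i 0)
                ((A *m derive1 C x) i 0).
    have -> : (fun y => (A *m C y + v) i 0) =
        (fun y => (A *m C y) i 0) + cst (v i 0).
      by apply/funext => y; rewrite mxE.
    rewrite -[(_ *m _) i 0]addr0; apply: is_deriveD.
    by apply: is_derive_mulmx => j; case: (dC x j Ix).
  have dT i := (dC x i Ix).2.
  exact: is_derive_continuous (is_deriveN (is_derive_dot dT dAC)).
apply/colP => i.
apply: (@derive_eq0_const _ I (fun x => (L *m C x) i 0)) => // x Ix.
have -> : 0 = (L *m derive1 C x) i 0.
  apply/esym.
  apply: (@linear_ode_eq0 _ I (fun y => (L *m derive1 C y) i 0) mu s0) => //;
    last by rewrite LT0 mxE.
  move=> y Iy.
  have -> : mu y * (L *m derive1 C y) i 0 = (L *m derive1n 2 C y) i 0.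
    rewrite (soliton_acceleration sol Iy) mulmxBr mulmxDr mulmxA LA Lv mul0mx.
    by rewrite -scalemxAr !(add0r, mxE) mulNr.
  by apply: is_derive_mulmx => j; case: (dC y j Iy).
by apply: is_derive_mulmx => j; case: (dC x j Ix).
Qed.

(** * Projection onto the null space *)

Lemma soliton_projection_affine (R : realType) (n : nat) (A : 'M[R]_n)
    (v : 'cV[R]_n) (I : set R) (C : R -> 'cV[R]_n) :
  antisym_mx A -> A *m v = 0 -> soliton 0 A v I C ->
  exists W : set 'cV[R]_n,
    [/\ affine_subspace (minn 2 (nullity A)) W,
        W `<=` nullspace A &
        forall s, I s ->
          exists2 p, W p & is_orth_proj (nullspace A) (C s) p].
Proof.
move=> asA Av sol.
have [s0 Is0] : I !=set0 by case: sol => -[].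
have [P [PA AP Psym Pid]] := orth_projector asA.
have Pidem (x : 'cV[R]_n) : P *m (P *m x) = P *m x.
  by apply: Pid; rewrite mulmxA AP mul0mx.
(* The directions that the projected curve uses, and a subspace [B] of the
   null space, of the required dimension, that contains them. *)
pose U := row_mx (P *m derive1 C s0) v.
have UK : (U^T <= kermx A^T)%MS.
  apply/sub_kermxP; rewrite -trmx_mul mul_mx_row mulmxA AP mul0mx Av.
  by rewrite row_mx0 trmx0.
have [|B [UB BK rB]] :=
  @intermediate_row_space _ _ _ _ (minn 2 (nullity A)) _ _ UK.
  rewrite geq_minr andbT leq_min /nullity mxrankS // andbT.
  exact: rank_leq_row.
have AB : A *m B^T = 0.
  by apply: trmx_inj; rewrite trmx_mul trmxK trmx0; exact/sub_kermxP.
(* The rows of [L] are the equations of [B], precomposed with the projector. *)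
pose L := (cokermx B)^T *m P.
have LU : (cokermx B)^T *m U = 0.
  by apply: trmx_inj; rewrite trmx_mul trmxK trmx0; apply/eqP; rewrite -submxE.
move: LU; rewrite mul_mx_row => LU.
have [LPT Lv] :
    (cokermx B)^T *m (P *m derive1 C s0) = 0 /\ (cokermx B)^T *m v = 0.
  by apply/eq_row_mx; rewrite LU row_mx0.
exists [set P *m C s0 + B^T *m t |
         t in [set: 'cV[R]_(minn 2 (nullity A))]]; split.
- by exists (P *m C s0), B^T; rewrite mxrank_tr.
- move=> _ [t _ <-]; rewrite /nullspace /= mulmxDr !mulmxA AP AB.
  by rewrite !mul0mx addr0.
- move=> s Is; exists (P *m C s); last first.
    split=> [|y Ay]; first by rewrite /nullspace /= mulmxA AP mul0mx.
    have xP : (C s - P *m C s)^T *m P = 0.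
      by rewrite -{2}Psym -trmx_mul mulmxBr Pidem subrr trmx0.
    by rewrite -(Pid y Ay) dotE mulmxA xP mul0mx mxE.
  have LC : L *m C s = L *m C s0.
    apply: (soliton_conserved sol) => //; rewrite /L -mulmxA ?PA ?mulmx0 //.
    by rewrite Pid.
  have /submxP[t tE] : ((P *m C s - P *m C s0)^T <= B)%MS.
    rewrite submxE; apply/eqP; apply: trmx_inj; rewrite trmx_mul trmxK trmx0.
    by rewrite mulmxBr !mulmxA -/L LC subrr.
  exists t^T => //.
  by rewrite -trmx_mul -tE trmxK addrC subrK.
Qed.

(** * Translating solitons: the tilt of the tangent *)

(** For [A = 0] the null space is everything and the projection is the identity. *)
Lemma translating_soliton_planar (R : realType) (n : nat) (v : 'cV[R]_n)
    (I : set R) (C : R -> 'cV[R]_n) :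
  soliton 0 0 v I C ->
  exists P : set 'cV[R]_n, affine_subspace (minn 2 n) P /\ C @` I `<=` P.
Proof.
move=> sol.
have [|W [Waff _ Wproj]] := soliton_projection_affine _ (mul0mx _ v) sol.
  by rewrite /antisym_mx trmx0 oppr0.
exists W; split.
  by rewrite /nullity trmx0 mxrank_ker mxrank0 subn0 in Waff.
move=> _ [s Is <-]; have [p Wp [_ /(_ (C s - p))]] := Wproj s Is.
rewrite /nullspace /= mul0mx => /(_ erefl) /dot_eq0 /eqP.
by rewrite subr_eq0 => /eqP ->.
Qed.

(** In the lemmas below, [e] is a vector, in most of them a unit vector, and the
    translation velocity is [c *: e]; the tilt of the curve is the component
    [dot e (derive1 C s)] of its tangent along [e]. *)
Lemma tangent_ode (R : realType) (n : nat) (c : R) (e : 'cV[R]_n)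
    (I : set R) (C : R -> 'cV[R]_n) (s : R) (i : 'I_n) :
  soliton 0 0 (c *: e) I C -> I s ->
  is_derive s 1 (fun x => derive1 C x i 0)
    (c * (e i 0 - dot e (derive1 C s) * derive1 C s i 0)).
Proof.
move=> sol Is; have [_] := soliton_derivable i sol Is.
rewrite (soliton_acceleration sol Is) mul0mx add0r dotZr (dotC _ e) !mxE.
by move=> dT; apply: (is_derive_eq dT); ring.
Qed.

Lemma tilt_ode (R : realType) (n : nat) (c : R) (e : 'cV[R]_n)
    (I : set R) (C : R -> 'cV[R]_n) (s : R) :
  soliton 0 0 (c *: e) I C -> dot e e = 1 -> I s ->
  is_derive s 1 (fun x => dot e (derive1 C x))
    (c * (1 - dot e (derive1 C s) ^+ 2)).
Proof.
move=> sol ee Is.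
have dT i : is_derive s 1 (fun x => derive1 C x i 0)
    ((c *: (e - dot e (derive1 C s) *: derive1 C s)) i 0).
  by rewrite !mxE; exact: tangent_ode sol Is.
have de i : is_derive s 1 (cst (e i 0)) ((0 : 'cV[R]_n) i 0).
  by rewrite mxE; exact: is_derive_cst.
apply: (is_derive_eq (@is_derive_dot _ _ (cst e) _ _ _ _ de dT)).
by rewrite -[0](scale0r e) dotZl dotZr dotDr dotNr dotZr ee; ring.
Qed.

Lemma dot_sub_proj (R : realType) (n : nat) (e t : 'cV[R]_n) :
  dot e e = 1 -> dot t t = 1 ->
  dot (t - dot e t *: e) (t - dot e t *: e) = 1 - dot e t ^+ 2.
Proof.
move=> ee tt.
by rewrite !(dotDl, dotDr, dotNl, dotNr, dotZl, dotZr) ee tt (dotC t e); ring.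
Qed.

Lemma tilt_defect_ge0 (R : realType) (n : nat) (e t : 'cV[R]_n) :
  dot e e = 1 -> dot t t = 1 -> 0 <= 1 - dot e t ^+ 2.
Proof. by move=> ee tt; rewrite -dot_sub_proj ?dot_ge0. Qed.

Lemma soliton_unit_tangent (R : realType) (n : nat) (alpha : R) (A : 'M[R]_n)
    (v : 'cV[R]_n) (I : set R) (C : R -> 'cV[R]_n) (s : R) :
  soliton alpha A v I C -> I s -> dot (derive1 C s) (derive1 C s) = 1.
Proof. by move=> [[_ _ _ curve] _] /curve[]. Qed.

Lemma tilt_defect_ode (R : realType) (n : nat) (c : R) (e : 'cV[R]_n)
    (I : set R) (C : R -> 'cV[R]_n) (s : R) :
  soliton 0 0 (c *: e) I C -> dot e e = 1 -> I s ->
  is_derive s 1 (fun x => 1 - dot e (derive1 C x) ^+ 2)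
    (- 2 * c * dot e (derive1 C s) * (1 - dot e (derive1 C s) ^+ 2)).
Proof.
move=> sol ee Is; have du := tilt_ode sol ee Is.
pose u x := dot e (derive1 C x).
have -> : (fun x => 1 - dot e (derive1 C x) ^+ 2) = cst 1 - u * u.
  by apply/funext => x; rewrite !fctE expr2.
apply: (is_derive_eq (is_deriveB (is_derive_cst (1 : R) s 1)
  (is_deriveM du du))).
by rewrite /u /GRing.scale /=; ring.
Qed.

Lemma tilt_sqrt_ode (R : realType) (n : nat) (c : R) (e : 'cV[R]_n)
    (I : set R) (C : R -> 'cV[R]_n) (s : R) :
  soliton 0 0 (c *: e) I C -> dot e e = 1 -> I s ->
  0 < 1 - dot e (derive1 C s) ^+ 2 ->
  is_derive s 1 (fun x => Num.sqrt (1 - dot e (derive1 C x) ^+ 2))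
    (- c * dot e (derive1 C s) * Num.sqrt (1 - dot e (derive1 C s) ^+ 2)).
Proof.
move=> sol ee Is q_gt0; pose q x := 1 - dot e (derive1 C x) ^+ 2.
apply: (is_derive_eq (@is_derive1_comp _ Num.sqrt q s _ _
  (is_derive1_sqrt q_gt0) (tilt_defect_ode sol ee Is))).
rewrite -/(q s).
have G_gt0 : 0 < Num.sqrt (q s) by rewrite sqrtr_gt0.
have qE : q s = Num.sqrt (q s) * Num.sqrt (q s).
  by rewrite -expr2 sqr_sqrtr // ltW.
rewrite [in X in _ * X]qE.
by field; rewrite gt_eqF.
Qed.

(** A tangent that is parallel to [e] at one point is parallel to [e] everywhere. *)
Lemma vertical_persists (R : realType) (n : nat) (c : R) (e : 'cV[R]_n)
    (I : set R) (C : R -> 'cV[R]_n) (s0 s : R) :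
  soliton 0 0 (c *: e) I C -> dot e e = 1 -> I s0 -> I s ->
  1 - dot e (derive1 C s0) ^+ 2 = 0 -> 1 - dot e (derive1 C s) ^+ 2 = 0.
Proof.
move=> sol ee Is0 Is q0.
have itvI : is_interval I by case: sol => -[].
pose u x := dot e (derive1 C x).
apply: (@linear_ode_eq0 _ I (fun x => 1 - u x ^+ 2)
  (fun x => (- 2 * c) * u x) s0) => // x Ix.
- exact: is_derive_continuous (is_deriveZ (- 2 * c) (tilt_ode sol ee Ix)).
- exact: tilt_defect_ode sol ee Ix.
Qed.

Lemma vertical_soliton_line (R : realType) (n : nat) (c : R) (e : 'cV[R]_n)
    (I : set R) (C : R -> 'cV[R]_n) (s0 : R) :
  soliton 0 0 (c *: e) I C -> dot e e = 1 -> I s0 ->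
  1 - dot e (derive1 C s0) ^+ 2 = 0 ->
  C @` I `<=` [set C s0 + t *: e | t in [set: R]].
Proof.
move=> sol ee Is0 q0 _ [s Is <-].
have itvI : is_interval I by case: sol => -[].
pose u x := dot e (derive1 C x).
have q x (Ix : I x) : 1 - u x ^+ 2 = 0 := vertical_persists sol ee Is0 Ix q0.
have TE x : I x -> derive1 C x = u x *: e.
  move=> Ix; apply/eqP; rewrite -subr_eq0; apply/eqP/dot_eq0.
  by rewrite (dot_sub_proj ee (soliton_unit_tangent sol Ix)) (q x Ix).
have uE x : I x -> u x = u s0.
  apply: (derive_eq0_const itvI) => // y Iy.
  by apply: (is_derive_eq (tilt_ode sol ee Iy)); rewrite q ?mulr0.
exists ((s - s0) * u s0) => //; apply/colP => i; rewrite !mxE.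
have h : C s i 0 - s * (u s0 * e i 0) = C s0 i 0 - s0 * (u s0 * e i 0).
  apply: (@derive_eq0_const _ I (fun x => C x i 0 - x * (u s0 * e i 0))) => // x Ix.
  have [dC _] := soliton_derivable i sol Ix.
  apply: (is_derive_eq (is_deriveB dC (is_deriveM (is_derive_id x 1)
    (is_derive_cst (u s0 * e i 0) x 1)))).
  by rewrite TE // mxE uE // /GRing.scale /=; ring.
by apply/eqP; rewrite -subr_eq0; apply/eqP; lra.
Qed.

(** The component of the tangent orthogonal to [e] keeps a fixed direction [f]:
    its coordinates and its length satisfy the same linear equation. *)
Lemma nonvertical_soliton_frame (R : realType) (n : nat) (c : R) (e : 'cV[R]_n)
    (I : set R) (C : R -> 'cV[R]_n) :
  soliton 0 0 (c *: e) I C -> dot e e = 1 ->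
  (forall s, I s -> 0 < 1 - dot e (derive1 C s) ^+ 2) ->
  exists f : 'cV[R]_n, [/\ dot e f = 0, dot f f = 1 &
    forall s, I s -> derive1 C s = dot e (derive1 C s) *: e +
      Num.sqrt (1 - dot e (derive1 C s) ^+ 2) *: f].
Proof.
move=> sol ee q_gt0.
have itvI : is_interval I by case: sol => -[].
have [s0 Is0] : I !=set0 by case: sol => -[].
pose u x := dot e (derive1 C x).
pose G x := Num.sqrt (1 - u x ^+ 2).
have G_gt0 x : I x -> 0 < G x by move=> Ix; rewrite sqrtr_gt0 q_gt0.
have GG x : I x -> G x * G x = 1 - u x ^+ 2.
  by move=> Ix; rewrite -expr2 sqr_sqrtr // ltW // q_gt0.
have G0 : G s0 != 0 by rewrite gt_eqF // G_gt0.
pose f := (G s0)^-1 *: (derive1 C s0 - u s0 *: e).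
have ef : dot e f = 0.
  by rewrite dotZr dotDr dotNr dotZr ee mulr1 subrr mulr0.
have ff : dot f f = 1.
  rewrite dotZl dotZr dot_sub_proj ?(soliton_unit_tangent sol Is0) //.
  rewrite -/(u s0) -GG //.
  by field.
exists f; split => // s Is; apply/colP => i.
rewrite mxE [(_ *: e) i 0]mxE [(_ *: f) i 0]mxE.
apply/eqP; rewrite -subr_eq0; apply/eqP.
pose h x := derive1 C x i 0 - (u x * e i 0 + G x * f i 0).
apply: (@linear_ode_eq0 _ I h (fun x => - c * u x) s0) => // [x Ix|x Ix|].
- exact: is_derive_continuous (is_deriveZ (- c) (tilt_ode sol ee Ix)).
- have du := tilt_ode sol ee Ix.
  have dG := tilt_sqrt_ode sol ee Ix (q_gt0 x Ix).
  apply: (is_derive_eq (is_deriveB (tangent_ode i sol Ix)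
    (is_deriveD (is_deriveM du (is_derive_cst (e i 0) x 1))
      (is_deriveM dG (is_derive_cst (f i 0) x 1))))).
  by rewrite /h /G /u /GRing.scale /=; ring.
- rewrite /h; have -> : f i 0 = (G s0)^-1 * (derive1 C s0 i 0 - u s0 * e i 0).
    by rewrite /f !mxE.
  by rewrite mulVKf // [_ + (_ - _)]addrC subrK subrr.
Qed.

(** * Translating solitons: the Grim Reaper *)

Lemma sqr_lt1_itv (R : realType) (x : R) : 0 < 1 - x ^+ 2 -> -1 < x < 1.
Proof. by move=> ?; apply/andP; split; nra. Qed.

Lemma tilt_surjective (R : realType) (n : nat) (c : R) (e : 'cV[R]_n)
    (C : R -> 'cV[R]_n) (t : R) :
  soliton 0 0 (c *: e) [set: R] C -> 0 < c -> dot e e = 1 ->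
  (forall s, 0 < 1 - dot e (derive1 C s) ^+ 2) -> -1 < t < 1 ->
  exists s, dot e (derive1 C s) = t.
Proof.
move=> sol c_gt0 ee q_gt0 t1.
pose u x := dot e (derive1 C x).
have u1 x : -1 < u x < 1 := sqr_lt1_itv (q_gt0 x).
(* [H] is twice the inverse hyperbolic tangent, and [tanh (c s)] solves
   [u' = c (1 - u^2)]. *)
pose H y : R := ln (1 + y) - ln (1 - y).
have Hu s : H (u s) = H (u 0) + 2 * c * s.
  have shift (a b x : R) : a - x = b - 2 * c * 0 -> a = b + x by lra.
  apply: shift.
  apply: (@derive_eq0_const _ [set: R] (fun x => H (u x) - 2 * c * x)) => // x _.
  have du : is_derive x 1 u (c * (1 - u x ^+ 2)) by exact: tilt_ode sol ee _.
  have /andP[ux1 ux2] := u1 x.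
  have dp : is_derive x 1 (fun y => 1 + u y) (c * (1 - u x ^+ 2)).
    by apply: (is_derive_eq (is_deriveD (is_derive_cst (1 : R) x 1) du));
      rewrite add0r.
  have dm : is_derive x 1 (fun y => 1 - u y) (- (c * (1 - u x ^+ 2))).
    by apply: (is_derive_eq (is_deriveB (is_derive_cst (1 : R) x 1) du));
      rewrite sub0r.
  have p_gt0 : 0 < 1 + u x by lra.
  have m_gt0 : 0 < 1 - u x by lra.
  have dlp := @is_derive1_comp _ (@ln R) _ x _ _ (is_derive1_ln p_gt0) dp.
  have dlm := @is_derive1_comp _ (@ln R) _ x _ _ (is_derive1_ln m_gt0) dm.
  apply: (is_derive_eq (is_deriveB (is_deriveB dlp dlm)
     (is_deriveZ (2 * c) (is_derive_id x 1)))).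
  rewrite /GRing.scale /=; field.
  by rewrite !gt_eqF.
exists ((H t - H (u 0)) / (2 * c)).
have := Hu ((H t - H (u 0)) / (2 * c)); set s := (_ / _).
have /andP[us1 us2] := u1 s; have /andP[t1' t2'] := t1.
have -> : H (u 0) + 2 * c * s = H t by rewrite /s; field; rewrite gt_eqF.
have [pu mu] : 0 < 1 + u s /\ 0 < 1 - u s by split; lra.
have [pt mt] : 0 < 1 + t /\ 0 < 1 - t by split; lra.
rewrite /H -!ln_div ?posrE //.
move=> /ln_inj; rewrite !posrE !divr_gt0 // => /(_ isT isT) /eqP.
rewrite eqr_div ?(gt_eqF mu) ?(gt_eqF mt) // => /eqP E.
have : 2 * (u s - t) = (1 + u s) * (1 - t) - (1 + t) * (1 - u s) by ring.
rewrite E subrr => /eqP; rewrite mulf_eq0 pnatr_eq0 /= subr_eq0 => /eqP; exact.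
Qed.

(** With [th = asin u] as parameter, the curve has coordinates [th] along [f] and
    [- ln (cos th)] along [e], up to a translation and the factor [c^-1]. *)
Lemma nonvertical_soliton_grim_reaper (R : realType) (n : nat) (c : R)
    (e : 'cV[R]_n) (I : set R) (C : R -> 'cV[R]_n) :
  soliton 0 0 (c *: e) I C -> 0 < c -> dot e e = 1 ->
  (forall s, I s -> 0 < 1 - dot e (derive1 C s) ^+ 2) ->
  exists G : set 'cV[R]_n,
    [/\ grim_reaper_copy G, C @` I `<=` G & I = [set: R] -> C @` I = G].
Proof.
move=> sol c_gt0 ee q_gt0.
have c0 : c != 0 by rewrite gt_eqF.
have itvI : is_interval I by case: sol => -[].
have [s0 Is0] : I !=set0 by case: sol => -[].
have [f [ef ff TE]] := nonvertical_soliton_frame sol ee q_gt0.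
pose u x := dot e (derive1 C x).
pose g x := Num.sqrt (1 - u x ^+ 2).
have g_gt0 x : I x -> 0 < g x by move=> Ix; rewrite sqrtr_gt0 q_gt0.
have u1 x : I x -> -1 < u x < 1 by move=> Ix; apply/sqr_lt1_itv/q_gt0.
pose th x := asin (u x).
have costh x : I x -> cos (th x) = g x.
  by move=> /u1/andP[? ?]; rewrite cos_asin // !ltW.
pose M (z0 z1 : R) := z0 *: f + z1 *: e.
pose p := C s0 - c^-1 *: M (th s0) (- ln (g s0)).
have CE s : I s -> C s = p + c^-1 *: M (th s) (- ln (g s)).
  move=> Is; apply/colP => i.
  have entry (x : 'cV[R]_n) a b a' b' :
      (x - c^-1 *: M a (- b) + c^-1 *: M a' (- b')) i 0 =
      x i 0 - c^-1 * (a * f i 0 - b * e i 0)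
            + c^-1 * (a' * f i 0 - b' * e i 0).
    by rewrite /M !mxE !mulNr.
  have K : C s i 0 - c^-1 * (th s * f i 0 - ln (g s) * e i 0) =
           C s0 i 0 - c^-1 * (th s0 * f i 0 - ln (g s0) * e i 0).
    apply: (@derive_eq0_const _ I (fun x =>
      C x i 0 - c^-1 * (th x * f i 0 - ln (g x) * e i 0))) => // x Ix.
    have [dC _] := soliton_derivable i sol Ix.
    have dth := @is_derive1_comp _ (@asin R) u x _ _
      (is_derive1_asin (u1 x Ix)) (tilt_ode sol ee Ix).
    have dlg := @is_derive1_comp _ (@ln R) g x _ _
      (is_derive1_ln (g_gt0 x Ix)) (tilt_sqrt_ode sol ee Ix (q_gt0 x Ix)).
    apply: (is_derive_eq (is_deriveB dC (is_deriveZ c^-1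
      (is_deriveB (is_deriveM dth (is_derive_cst (f i 0) x 1))
                  (is_deriveM dlg (is_derive_cst (e i 0) x 1)))))).
    have Ti : derive1 C x i 0 = u x * e i 0 + g x * f i 0.
      by rewrite {1}(TE x Ix) mxE [(_ *: e) i 0]mxE [(_ *: f) i 0]mxE.
    have gg : 1 - u x ^+ 2 = g x * g x.
      by rewrite -expr2 sqr_sqrtr // ltW // q_gt0.
    rewrite Ti -/(u x) -/(g x) gg /GRing.scale /=.
    by field; rewrite c0 gt_eqF // g_gt0.
  move/eqP: K; rewrite subr_eq => /eqP ->.
  exact: esym (entry (C s0) (th s0) (ln (g s0)) (th s) (ln (g s))).
pose qcol (j : 'I_2) := if j == ord0 then f else e.
pose Q := \matrix_(i < n, j < 2) qcol j i 0.
have QQ : Q^T *m Q = 1%:M.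
  apply/matrixP => i j; have -> : (Q^T *m Q) i j = dot (qcol i) (qcol j).
    by rewrite mxE; apply: eq_bigr => k _; rewrite !mxE.
  rewrite mxE; case: i j => [[|[|//]] hi] [[|[|//]] hj] //=.
  by rewrite /qcol /= dotC.
have QM (z : 'cV[R]_2) : Q *m z = M (z ord0 0) (z ord_max 0).
  apply/colP => i; rewrite mxE big_ord_recl big_ord1 !mxE /qcol /=.
  rewrite (_ : lift _ _ = ord_max) ?[f i 0 * _]mulrC ?[e i 0 * _]mulrC //.
  exact: val_inj.
exists [set p + c^-1 *: (Q *m z) | z in @grim_reaper R].
have sub : C @` I `<=` [set p + c^-1 *: (Q *m z) | z in @grim_reaper R].
  move=> _ [s Is <-].
  have /andP[us1 us2] := u1 s Is.
  exists (\col_(j < 2) if j == ord0 then th s else - ln (g s)).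
    rewrite /grim_reaper /= !mxE /= costh //; split => //.
    by rewrite asin_gtNpi2 ?asin_ltpi2 ?us1 ?us2 ?ltW.
  by rewrite QM !mxE /= -CE.
split => //.
  by exists p, c^-1, Q; rewrite invr_gt0.
move=> IT; apply/seteqP; split => // _ [z [/andP[z1 z2] z3] <-].
have q_gt0' s : 0 < 1 - u s ^+ 2 by apply: q_gt0; rewrite IT.
have [s us] : exists s, u s = sin (z ord0 0).
  apply: (tilt_surjective _ c_gt0 ee q_gt0'); first by rewrite -IT.
  apply: sqr_lt1_itv; rewrite -cos2sin2 exprn_gt0 // cos_gt0_pihalf //.
  by rewrite z1 z2.
have Is : I s by rewrite IT.
have ths : th s = z ord0 0 by rewrite /th us sinK // in_itv /= !ltW.
by exists s => //; rewrite QM z3 -ths costh // -CE.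
Qed.

Theorem lemma5p2 (R : realType) (n : nat) :
  (forall (A : 'M[R]_n) (v : 'cV[R]_n) (I : set R) (C : R -> 'cV[R]_n),
     antisym_mx A -> A *m v = 0 -> soliton 0 A v I C ->
     exists W : set 'cV[R]_n,
       [/\ affine_subspace (minn 2 (nullity A)) W,
           W `<=` nullspace A &
           forall s, I s ->
             exists2 p, W p & is_orth_proj (nullspace A) (C s) p])
  /\
  (forall (v : 'cV[R]_n) (I : set R) (C : R -> 'cV[R]_n),
     v != 0 -> soliton 0 0 v I C ->
     (exists P : set 'cV[R]_n,
        affine_subspace (minn 2 n) P /\ C @` I `<=` P)
     /\
     ((exists p : 'cV[R]_n, C @` I `<=` [set p + t *: v | t in [set: R]])
      \/
      (exists G : set 'cV[R]_n,
        [/\ grim_reaper_copy G, C @` I `<=` G &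
            I = [set: R] -> C @` I = G]))).
Proof.
split; first exact: soliton_projection_affine.
move=> v I C v0 sol; split; first exact: translating_soliton_planar sol.
pose c := Num.sqrt (dot v v); pose e := c^-1 *: v.
have c_gt0 : 0 < c.
  rewrite sqrtr_gt0 lt_def dot_ge0 andbT.
  by apply: contraNneq v0 => /dot_eq0 ->.
have cc : c * c = dot v v by rewrite -expr2 sqr_sqrtr ?dot_ge0.
have vE : v = c *: e by rewrite scalerA divff ?scale1r ?gt_eqF.
have ee : dot e e = 1 by rewrite dotZl dotZr -cc; field; rewrite gt_eqF.
have [s0 Is0] : I !=set0 by case: sol => -[].
rewrite vE in sol.
have [q0|q0] := eqVneq (1 - dot e (derive1 C s0) ^+ 2) 0.
  left; exists (C s0) => x /(vertical_soliton_line sol ee Is0 q0)[t _ <-].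
  by exists (t / c) => //; rewrite -scalerA.
right; apply: (nonvertical_soliton_grim_reaper sol c_gt0 ee) => s Is.
rewrite lt_def tilt_defect_ge0 ?(soliton_unit_tangent sol Is) // andbT.
by apply: contraNneq q0 => /(vertical_persists sol ee Is Is0) ->.
Qed.
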